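(* Vertex Cover Reconfiguration restricted to instances whose input graph is a tree can be solved in time polynomial in $n=|V(G)|$.
   Context: All graphs are finite, simple and undirected. A vertex cover of a graph $G$ is a set $C\subseteq V(G)$ such that every edge of $G$ has at least one endpoint in $C$. An instance of Vertex Cover Reconfiguration is a tuple $(G,S,T,k,\ell)$ where $G$ is a graph, $k,\ell$ are positive integers, and $S,T$ are vertex covers of $G$ with $|S|,|T|\le k$. The question is whether $S$ can be transformed into $T$ by a sequence of at most $\ell$ steps, each adding a single vertex to or removing a single vertex from the current set, such that after every step the current set is a vertex cover of $G$ of size at most $k$. *)

(* Defs.v *)
(* MathComp world. *)
From mathcomp Require Import all_boot all_order all_algebra.

Set Implicit Arguments.
Unset Strict Implicit.
Unset Printing Implicit Defensive.

(* ---- Trees and vertex covers; a graph is given by its adjacency relation ---- *)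

Section Graphs.
Variables (V : finType) (e : rel V).

Definition simple_graph : Prop := symmetric e /\ irreflexive e.

(* [ucycle e c] says that [c] is a closed [e]-walk without repeated vertices;
   the size bound excludes the closed walks [:: x; y] along a single edge. *)
Definition acyclic : Prop := forall c : seq V, 2 < size c -> ~ ucycle e c.

Definition is_tree : Prop :=
  [/\ 0 < #|V|, forall x y : V, connect e x y & acyclic].

Definition vertex_cover (C : {set V}) : bool :=
  [forall x, forall y, e x y ==> (x \in C) || (y \in C)].

Definition reconf_step (A B : {set V}) : bool :=
  [exists v, (v \notin A) && (B == v |: A) || (v \in A) && (B == A :\ v)].

Definition reconfigurable (k l : nat) (S T : {set V}) : Prop :=
  exists s : seq {set V},
    [/\ size s <= l, path reconf_step S s, last S s = T
      & all (fun C => vertex_cover C && (#|C| <= k)) s].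

End Graphs.

Record vcr_instance := VCRInstance {
  vcr_n : nat;
  vcr_edge : rel 'I_vcr_n;
  vcr_source : {set 'I_vcr_n};
  vcr_target : {set 'I_vcr_n};
  vcr_k : nat;
  vcr_l : nat;
  vcr_graphP : simple_graph vcr_edge;
  vcr_k_gt0 : 0 < vcr_k;
  vcr_l_gt0 : 0 < vcr_l;
  vcr_sourceP : vertex_cover vcr_edge vcr_source;
  vcr_targetP : vertex_cover vcr_edge vcr_target;
  vcr_source_le : #|vcr_source| <= vcr_k;
  vcr_target_le : #|vcr_target| <= vcr_k
}.

Definition vcr_yes (I : vcr_instance) : Prop :=
  reconfigurable (@vcr_edge I) (vcr_k I) (vcr_l I) (vcr_source I) (vcr_target I).

(* n, k, l, the characteristic vectors of the two covers, and the adjacency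
   matrix in row-major order. *)
Definition vcr_encode (I : vcr_instance) : seq nat :=
  [:: vcr_n I; vcr_k I; vcr_l I]
  ++ [seq nat_of_bool (x \in vcr_source I) | x <- enum 'I_(vcr_n I)]
  ++ [seq nat_of_bool (x \in vcr_target I) | x <- enum 'I_(vcr_n I)]
  ++ [seq nat_of_bool (vcr_edge x y)
       | x <- enum 'I_(vcr_n I), y <- enum 'I_(vcr_n I)].

(* ---- Unit-cost random access machine ----
   Addition and truncated subtraction are the only arithmetic operations: with
   unit-cost multiplication, polynomially many steps could build numbers of
   exponential length and the model would no longer capture polynomial time. *)

(* The first operand is a destination register, except in [Write a r], which
   writes register [r] to the memory cell addressed by register [a]. *)
Inductive instr :=
| Const of nat & nat
| Add of nat & nat & nat
| Sub of nat & nat & nat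
| Read of nat & nat
| Write of nat & nat
| JumpPos of nat & nat
| Halt of bool.

Definition program := seq instr.

Record config := Config { pc : nat; regs : nat -> nat; mem : nat -> nat }.

Definition update (f : nat -> nat) (i v : nat) : nat -> nat :=
  fun j => if j == i then v else f j.

(* [inr b] is halting with answer [b]; running past the end of the program
   rejects. *)
Definition step (P : program) (c : config) : config + bool :=
  let: Config i R M := c in
  match nth (Halt false) P i with
  | Const r v => inl (Config i.+1 (update R r v) M)
  | Add r a b => inl (Config i.+1 (update R r (R a + R b)) M)
  | Sub r a b => inl (Config i.+1 (update R r (R a - R b)) M)
  | Read r a => inl (Config i.+1 (update R r (M (R a))) M)
  | Write a r => inl (Config i.+1 R (update M (R a) (R r)))
  | JumpPos r j => inl (Config (if 0 < R r then j else i.+1) R M)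
  | Halt b => inr b
  end.

(* [run P t c = Some b]: started in [c], [P] halts with answer [b] after
   executing at most [t] instructions. *)
Fixpoint run (P : program) (t : nat) (c : config) : option bool :=
  if t is t'.+1 then
    match step P c with
    | inl c' => run P t' c'
    | inr b => Some b
    end
  else None.

Definition init (x : seq nat) : config := Config 0 (fun=> 0) (nth 0 x).

(* The decision problem with question [yes], restricted to the instances
   satisfying [dom], is solvable in time polynomial in [size_of]. *)
Definition solvable_in_polytime (I : Type) (encode : I -> seq nat)
    (size_of : I -> nat) (dom yes : I -> Prop) : Prop :=
  exists (P : program) (p : {poly nat}), forall x : I, dom x ->
    exists b : bool,
      run P (p.[size_of x])%R (init (encode x)) = Some b /\ (b <-> yes x).

(* Main.v *)
Require Import Defs.
From mathcomp Require Import all_boot all_order all_algebra.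
From mathcomp Require Import zify.

(* If S and T are vertex covers of size less than k of a forest, then the shortest
   reconfiguration takes |S xor T| steps: the symmetric difference induces a
   forest, hence contains a vertex x with at most one neighbour z inside it. If x
   is in S, add z to S and then remove x; if x is in T, do the same from the other
   end; then repeat. A cover of size k other than the final one can only be left
   by removing a vertex. So, for S different from T, an optimal sequence has
   the form S -> S' -> T' -> T where S' and T' are covers of size less than k, S'
   is S or S minus a vertex, T' is T or T minus a vertex, and the three parts take
   |S xor S'|, |S' xor T'| and |T' xor T| steps.

   The machine tries all pairs (S', T'). This search is one arithmetic expression
   with addition, truncated subtraction, memory access and sums over the vertices;
   compiling such an expression gives a program whose running time is exactly a
   polynomial in n. Truncated subtraction expresses the tests: a - b = 0 means
   a <= b, and 1 - a is the negation of "a > 0". *)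

Set Implicit Arguments.
Unset Strict Implicit.
Unset Printing Implicit Defensive.

(** * Symmetric-difference distance between vertex sets *)

Section Distance.
Variable V : finType.
Implicit Types (A B C : {set V}) (x : V).

(** This is the size of the symmetric difference, written as a sum over all vertices so that it
    matches a [Sum] of the term language. *)
Definition hdist A B : nat := \sum_x ((x \in A) (+) (x \in B)).

Lemma hdistC A B : hdist A B = hdist B A.
Proof. by apply: eq_bigr => x _; rewrite addbC. Qed.

Lemma hdist_eq0 A B : (hdist A B == 0) = (A == B).
Proof.
rewrite /hdist sum_nat_eq0; apply/forallP/eqP => [AB | -> x]; last first.
  by rewrite addbb.
by apply/setP => x; have := AB x; case: (x \in A); case: (x \in B).
Qed.

Lemma hdistxx A : hdist A A = 0.
Proof. by apply/eqP; rewrite hdist_eq0. Qed.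

Lemma hdist_triangle B A C : hdist A C <= hdist A B + hdist B C.
Proof.
rewrite -big_split leq_sum // => x _ /=.
by case: (x \in A); case: (x \in B); case: (x \in C).
Qed.

Lemma hdist_setD1 A B x :
  x \in A -> x \notin B -> hdist A B = (hdist (A :\ x) B).+1.
Proof.
move=> xA xB; rewrite /hdist (bigD1 x) //= [in RHS](bigD1 x) //=.
rewrite !inE eqxx xA (negPf xB) add0n add1n; congr _.+1.
by apply: eq_bigr => y /negPf yx; rewrite !inE yx.
Qed.

Lemma hdist_setU1 A B x :
  x \notin A -> x \in B -> hdist A B = (hdist (x |: A) B).+1.
Proof.
move=> xA xB; rewrite /hdist (bigD1 x) //= [in RHS](bigD1 x) //=.
rewrite !inE eqxx xB (negPf xA) add0n add1n; congr _.+1.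
by apply: eq_bigr => y /negPf yx; rewrite !inE yx.
Qed.

Lemma reconf_step_sym : symmetric (@reconf_step V).
Proof.
suff imp A B : reconf_step A B -> reconf_step B A.
  by move=> A B; apply/idP/idP; apply: imp.
case/existsP=> x /orP[] /andP[xA /eqP->]; apply/existsP; exists x;
  rewrite !inE eqxx /=.
  by rewrite setU1K // eqxx.
by rewrite setD1K // eqxx.
Qed.

Lemma hdist_step A B : reconf_step A B -> hdist A B = 1.
Proof.
case/existsP=> x /orP[] /andP[xA /eqP->].
  by rewrite (@hdist_setU1 _ _ x) ?hdistxx // !inE eqxx.
by rewrite (@hdist_setD1 _ _ x) ?hdistxx // !inE eqxx.
Qed.

Lemma hdist_path A s : path (@reconf_step V) A s -> hdist A (last A s) <= size s.
Proof.
elim: s A => [|B s IH] A /=; first by rewrite leqn0 hdist_eq0.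
case/andP=> /hdist_step AB /IH le_s; apply: leq_trans (hdist_triangle B A _) _.
by rewrite AB add1n ltnS.
Qed.

End Distance.

(** * Shortest reconfiguration sequences in forests *)

Section Reconfiguration.
Variables (V : finType) (e : rel V) (k : nat).
Implicit Types (A B C S T : {set V}) (s : seq {set V}).

Local Notation feasible := (fun C => vertex_cover e C && (#|C| <= k)).

Lemma vertex_coverP C :
  reflect (forall x y, e x y -> (x \in C) || (y \in C)) (vertex_cover e C).
Proof.
apply: (iffP forallP) => [H x y exy | H x]; last first.
  by apply/forallP => y; apply/implyP/H.
by have /forallP/(_ y)/implyP := H x; apply.
Qed.

Lemma reconfigurable_refl l S : reconfigurable e k l S S.
Proof. by exists [::]. Qed.

Lemma reconfigurable_step S T :
  reconf_step S T -> feasible T -> reconfigurable e k 1 S T.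
Proof. by move=> ST /= fT; exists [:: T]; rewrite /= ST fT. Qed.

Lemma reconfigurable_trans T l1 l2 S U :
  reconfigurable e k l1 S T -> reconfigurable e k l2 T U ->
  reconfigurable e k (l1 + l2) S U.
Proof.
move=> [s1 [z1 p1 t1 a1]] [s2 [z2 p2 t2 a2]]; exists (s1 ++ s2).
by rewrite size_cat leq_add // cat_path last_cat all_cat t1 p1 p2 a1 a2.
Qed.

Lemma reconfigurable_le l1 l2 S T :
  l1 <= l2 -> reconfigurable e k l1 S T -> reconfigurable e k l2 S T.
Proof. by move=> le [s [z p t a]]; exists s; split=> //; apply: leq_trans le. Qed.

(** [reconfigurable] checks only the sets after the first one. The reversed sequence ends in [S], so
    [S] itself must be feasible. *)
Lemma reconfigurable_sym l S T :
  feasible S -> reconfigurable e k l S T -> reconfigurable e k l T S.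
Proof.
move=> fS [s [z p <- a]]; exists (rev (belast S s)); split.
- by rewrite size_rev size_belast.
- rewrite rev_path; apply: sub_path p => A B /=; by rewrite reconf_step_sym.
- by case: s {z p a} => //= A s; rewrite rev_cons last_rcons.
- rewrite all_rev; have: all feasible (S :: s) by rewrite /= fS.
  by rewrite lastI all_rcons => /andP[].
Qed.

Lemma reconfigurable_hdist l S T : reconfigurable e k l S T -> hdist S T <= l.
Proof. by move=> [s [z p <- _]]; apply: leq_trans z; apply: hdist_path. Qed.

Definition shrink S S' : Prop := S' = S \/ exists2 v, v \in S & S' = S :\ v.

Lemma shrink_reconfigurable S S' :
  shrink S S' -> feasible S' -> reconfigurable e k (hdist S S') S S'.
Proof.
case=> [-> _ | [v vS ->] fS']; first exact: reconfigurable_refl.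
have st : reconf_step S (S :\ v) by apply/existsP; exists v; rewrite vS eqxx orbT.
by rewrite (hdist_step st); apply: reconfigurable_step.
Qed.

(** At size [k] the first step must be a removal, and [S <> T] guarantees that there is a first
    step. Below [k], take [S' = S]. *)
Lemma first_shrink l S T :
  vertex_cover e S -> #|S| <= k -> S <> T \/ #|S| < k ->
  reconfigurable e k l S T ->
  exists S' l', [/\ shrink S S', vertex_cover e S', #|S'| < k,
    hdist S S' + l' <= l & reconfigurable e k l' S' T].
Proof.
move=> vS le_k; have [lt_k _ rST | ge_k] := ltnP #|S| k.
  exists S, l; split=> //; first by left.
  by rewrite hdistxx.
have Sk : #|S| = k by apply/eqP; rewrite eqn_leq le_k.
case=> // nST [[|A s] [/= z p t a]]; first by case: nST.
case/andP: p => st p; case/andP: a => /andP[vA cA] a.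
exists A, (size s); split=> //.
- case/existsP: st => v /orP[] /andP[vS' /eqP AE]; last by right; exists v.
  by move: cA; rewrite AE cardsU1 vS' Sk ltnn.
- case/existsP: st => v /orP[] /andP[vS' /eqP AE].
    by move: cA; rewrite AE cardsU1 vS' Sk ltnn.
  by rewrite -Sk AE [#|S|](cardsD1 v) vS'.
- by rewrite (hdist_step st).
- by exists s.
Qed.

Hypotheses (e_simple : simple_graph e) (e_acyclic : acyclic e).

Let e_sym : symmetric e := e_simple.1.
Let e_irr : irreflexive e := e_simple.2.

(* If every vertex of X had two neighbours in X, simple paths in X could be
   extended forever at their head: a neighbour other than the next vertex of
   the path is new, since otherwise it would close a cycle. *)
Lemma acyclic_leaf (X : {set V}) x0 : x0 \in X ->
  exists2 x, x \in X & exists z, forall y, y \in X -> e x y -> y = z.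
Proof.
move=> x0X.
have [/exists_inP[x xX /existsP[z /forall_inP leaf]] | noleaf] :=
    boolP [exists x in X, exists z, forall y in X, e x y ==> (y == z)].
  by exists x => //; exists z => y yX exy; apply/eqP/(implyP (leaf y yX)).
have next x z : x \in X -> exists y, [/\ y \in X, e x y & y != z].
  move=> xX; move: noleaf; rewrite negb_exists_in => /forall_inP/(_ x xX).
  rewrite negb_exists => /forallP/(_ z); rewrite negb_forall_in.
  by case/exists_inP=> y yX; rewrite negb_imply => /andP[]; exists y.
have long m : exists x p,
    [/\ size p = m, path e x p, uniq (x :: p) & {subset x :: p <= X}].
  elim: m => [|m [x [p [zp pp up sp]]]].
    by exists x0, [::]; split=> // y; rewrite inE => /eqP->.
  have [y [yX exy yp]] := next x (head x p) (sp x (mem_head x p)).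
  have [yxp|nyp] := boolP (y \in x :: p); last first.
    exists y, (x :: p); split=> //=; first by rewrite zp.
    - by rewrite e_sym exy.
    - by rewrite nyp.
    - by move=> u; rewrite inE => /predU1P[-> // | /sp].
  move: yxp; rewrite inE => /predU1P[yx | yinp]; first by rewrite yx e_irr in exy.
  case: p => [//|z q] in zp pp up sp yp yinp *.
  move: yinp; rewrite inE (negPf yp) /= => yq.
  exfalso; clear zp sp; case/splitPr: yq pp up => q1 q2 pp up.
  apply: (e_acyclic (c := [:: x, z & rcons q1 y])).
    by rewrite /= size_rcons.
  rewrite /ucycle -cat_rcons in pp up *; apply/andP; split.
    move: pp => /= /andP[-> /=]; rewrite cat_path => /andP[pq _].
    by rewrite rcons_path pq last_rcons e_sym.
  by move: up; rewrite -cat_cons -cat_cons cat_uniq => /andP[].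
have [x [p [zp _ up _]]] := long #|V|.
by have := max_card (mem (x :: p)); rewrite (card_uniqP up) /= zp ltnn.
Qed.

(** The strict bounds leave room to add one vertex before the leaf [x] is removed. The removal
    brings the size back to at most that of [S], so the induction on the distance continues. *)
Lemma reconfigurable_forest S T :
  vertex_cover e S -> vertex_cover e T -> #|S| < k -> #|T| < k ->
  reconfigurable e k (hdist S T) S T.
Proof.
have [m] := ubnP (hdist S T); elim: m S T => // m IH S T; rewrite ltnS => le_m.
move=> vS vT ltS ltT; have [->|neST] := eqVneq S T; first exact: reconfigurable_refl.
pose X := [set x | (x \in S) (+) (x \in T)].
have [x0 x0X] : exists x, x \in X.
  apply/set0Pn; apply: contra neST => /eqP X0; apply/eqP/setP => x.
  by have := in_set0 x; rewrite -X0 inE; case: (x \in S); case: (x \in T).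
have [x] := acyclic_leaf x0X; rewrite {x0 x0X neST}/X inE.
wlog xS : S T vS vT ltS ltT le_m / x \in S => [WL xX leaf|].
  have [xS|nxS] := boolP (x \in S); first exact: WL xX leaf.
  apply: reconfigurable_sym; first by rewrite vT ltnW.
  rewrite hdistC; apply: WL => //.
  - by rewrite hdistC.
  - by move: xX; rewrite (negPf nxS).
  - by rewrite addbC.
  - case: leaf => z leaf; exists z => y; rewrite inE addbC => yX; apply: leaf.
    by rewrite inE.
rewrite xS /= => xT [z leaf].
have nbrT y : e x y -> y \in T.
  by move=> exy; have /vertex_coverP/(_ x y exy) := vT; rewrite (negPf xT).
(* If [x] has no neighbour in the symmetric difference, [z] is an arbitrary vertex. It is added only
   when this brings the set closer to [T]. *)
pose S1 := if (z \notin S) && (z \in T) then z |: S else S.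
have subS : S \subset S1 by rewrite /S1; case: ifP => // _; rewrite subsetUr.
have cS1 : #|S1 :\ x| <= #|S|.
  have : #|S1| <= #|S|.+1.
    by rewrite /S1; case: ifP => // _; rewrite cardsU1; case: (z \notin S).
  by rewrite (cardsD1 x) (subsetP subS x xS).
have x1 : x \in S1 := subsetP subS x xS.
have cover1 : vertex_cover e S1.
  apply/vertex_coverP => u v /(vertex_coverP _ vS _ _).
  by case/orP=> /(subsetP subS) ->; rewrite ?orbT.
(* As [x] is not in [T], all its neighbours are; one outside [S] lies in the symmetric difference,
   so it is [z], which [S1] contains. *)
have cover2 : vertex_cover e (S1 :\ x).
  have nbr y : e x y -> y \in S1 :\ x.
    move=> exy; rewrite !inE; have yT := nbrT y exy.
    have -> : y != x by apply: contraTneq exy => ->; rewrite e_irr.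
    have [/(subsetP subS) // | nyS] := boolP (y \in S).
    have yz : y = z by apply: leaf; rewrite // inE (negPf nyS) yT.
    by rewrite /S1 -yz nyS yT setU11.
  apply/vertex_coverP => u v euv; rewrite !inE.
  have [ux | nux] := eqVneq u x; first by rewrite ux in euv;
    have := nbr _ euv; rewrite !inE.
  have [vx | nvx] := eqVneq v x.
    by rewrite vx e_sym in euv; have := nbr _ euv; rewrite !inE nux /= orbF.
  exact: vertex_coverP cover1 _ _ euv.
have d1 : hdist S T = hdist S S1 + hdist S1 T.
  rewrite /S1; case: ifP => [/andP[zS zT] | _]; last by rewrite hdistxx.
  rewrite (@hdist_setU1 _ S T z) // (@hdist_setU1 _ S _ z) ?setU11 //.
  by rewrite hdistxx.
have d2 : hdist S1 T = (hdist (S1 :\ x) T).+1 by apply: hdist_setD1.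
rewrite d1 d2 -add1n.
apply: (@reconfigurable_trans S1).
  rewrite /S1; case: ifP => [/andP[zS zT] | _]; last exact: reconfigurable_refl.
  have st : reconf_step S (z |: S) by apply/existsP; exists z; rewrite zS eqxx.
  rewrite (hdist_step st); apply: reconfigurable_step => //.
  move: cover1; rewrite /S1 zS zT /= => -> /=.
  by rewrite cardsU1 zS.
apply: (@reconfigurable_trans (S1 :\ x)).
  apply: reconfigurable_step; last by rewrite cover2 (leq_trans cS1) // ltnW.
  by apply/existsP; exists x; rewrite x1 eqxx orbT.
apply: IH => //; last exact: leq_ltn_trans cS1 ltS.
by apply: leq_trans le_m; rewrite d1 d2 addnS ltnS leq_addl.
Qed.

(** From left to right, [first_shrink] is applied at [S], then at [T] to the reversed remainder;
    what is left between [S'] and [T'] takes at least their distance. *)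
Lemma reconfigurable_iff_shrink l S T :
  vertex_cover e S -> vertex_cover e T -> #|S| <= k -> #|T| <= k ->
  reconfigurable e k l S T <->
  S = T \/ exists S' T',
    [/\ shrink S S', shrink T T', vertex_cover e S' && vertex_cover e T',
      (#|S'| < k) && (#|T'| < k)
      & hdist S S' + hdist S' T' + hdist T' T <= l].
Proof.
move=> vS vT leS leT; split=> [rST | [-> |]].
- have [-> | /eqP neST] := eqVneq S T; [by left | right].
  have [S' [l' [sS vS' cS' le1 r1]]] := first_shrink vS leS (or_introl neST) rST.
  have fS' : vertex_cover e S' && (#|S'| <= k) by rewrite vS' ltnW.
  (* If [T = S'], the remainder may be empty, but then [T] inherits the strict bound from [S']. *)
  have hT : T <> S' \/ #|T| < k by have [->|/eqP] := eqVneq T S'; [right | left].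
  have [T' [l2 [sT vT' cT' le2 r2]]] :=
    first_shrink vT leT hT (reconfigurable_sym fS' r1).
  exists S', T'; split=> //; rewrite ?vS' ?cS' //.
  apply: leq_trans le1; rewrite -addnA leq_add2l; apply: leq_trans le2.
  by rewrite addnC hdistC leq_add2l hdistC; apply: reconfigurable_hdist.
- exact: reconfigurable_refl.
- case=> S' [T' [sS sT /andP[vS' vT'] /andP[cS' cT'] le_l]].
  apply: reconfigurable_le le_l _.
  have fS' : vertex_cover e S' && (#|S'| <= k) by rewrite vS' ltnW.
  have fT' : vertex_cover e T' && (#|T'| <= k) by rewrite vT' ltnW.
  apply: reconfigurable_trans; last first.
    rewrite hdistC; apply: reconfigurable_sym (shrink_reconfigurable sT fT').
    by rewrite vT leT.
  apply: reconfigurable_trans; first exact: shrink_reconfigurable sS fS'.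
  exact: reconfigurable_forest.
Qed.

End Reconfiguration.

(* A free variable is an index into the environment counted from its outer end,
   so a term keeps its meaning when it is moved below further binders. *)
Inductive term :=
| Cst of nat
| Var of nat
| Plus of term & term
| Minus of term & term
| Fetch of term
| Sum of bool & term.

(** * Evaluation of terms and their compilation to machine code *)

Section Semantics.
Variables (M : nat -> nat) (n : nat).

(* An unbound variable reads register 0, which holds 1 (see [compile]); hence
   the default. *)
Fixpoint eval (env : seq nat) (t : term) : nat :=
  match t with
  | Cst c => c
  | Var j => nth 1 env j
  | Plus a b => eval env a + eval env b
  | Minus a b => eval env a - eval env b
  | Fetch a => M (eval env a)
  | Sum b a => \sum_(x < n + b) eval (rcons env x) a
  end.

(** For a sum: four instructions of set-up, ending with a jump to the loop test; in each round the
    test, the decrement and the accumulation besides the body; and one final failing test. *)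
Fixpoint cost (t : term) : nat :=
  match t with
  | Cst _ => 1
  | Var _ => 2
  | Plus a b | Minus a b => cost a + (cost b + 1)
  | Fetch a => cost a + 1
  | Sum b a => 4 + ((n + b) * (cost a + 3) + 1)
  end.

(* [p] is the address of the code (jumps are absolute), [rho] lists the registers
   of the free variables, and the value is left in [d]; registers below [d] are
   not modified. Registers 0, 1 and 2 hold 1, n and n + 1. In a sum,
   register [d.+1] is both the loop counter and the bound variable. *)
Fixpoint compile (p : nat) (rho : seq nat) (d : nat) (t : term) : program :=
  match t with
  | Cst c => [:: Const d c]
  | Var j => [:: Defs.Sub d d d; Add d d (nth 0 rho j)]
  | Plus a b =>
      let code := compile p rho d a in
      code ++ compile (p + size code) rho d.+1 b ++ [:: Add d d d.+1]
  | Minus a b =>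
      let code := compile p rho d a in
      code ++ compile (p + size code) rho d.+1 b ++ [:: Defs.Sub d d d.+1]
  | Fetch a => compile p rho d a ++ [:: Read d d]
  | Sum b a =>
      let body := compile (p + 5) (rcons rho d.+1) d.+2 a in
      [:: Defs.Sub d d d; Defs.Sub d.+1 d.+1 d.+1; Add d.+1 d.+1 b.+1;
          JumpPos 0 (p + 5 + size body).+1; Defs.Sub d.+1 d.+1 0]
      ++ body ++ [:: Add d d d.+2; JumpPos d.+1 (p + 4)]
  end.

(** Quantifying over the remaining fuel [t] makes exact running times add up under composition. *)
Definition runs (P : program) (m : nat) (c c' : config) : Prop :=
  forall t, run P (m + t) c = run P t c'.

Lemma runs_trans P m1 m2 c1 c2 c3 :
  runs P m1 c1 c2 -> runs P m2 c2 c3 -> runs P (m1 + m2) c1 c3.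
Proof. by move=> r1 r2 t; rewrite -addnA r1 r2. Qed.

Lemma runs_step P c c' : step P c = inl c' -> runs P 1 c c'.
Proof. by move=> st t; rewrite add1n /= st. Qed.

Definition code_at (P : program) (p : nat) (code : program) : Prop :=
  forall i, i < size code -> nth (Halt false) P (p + i) = nth (Halt false) code i.

Lemma code_at_cat P p c1 c2 :
  code_at P p (c1 ++ c2) -> code_at P p c1 /\ code_at P (p + size c1) c2.
Proof.
move=> at12; split=> i lt_i.
  by rewrite at12 ?nth_cat ?lt_i // size_cat ltn_addr.
by rewrite -addnA at12 ?size_cat ?ltn_add2l // nth_cat ltnNge leq_addr addKn.
Qed.

Lemma code_at_cons P p i c :
  code_at P p (i :: c) -> nth (Halt false) P p = i /\ code_at P p.+1 c.
Proof.
move=> at_ic; split; first by rewrite -[p]addn0 at_ic.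
by move=> j lt_j; rewrite addSnnS at_ic.
Qed.

(** Subterms are computed in registers from [d] upwards, so the constants and the variables in lower
    registers, and a first operand kept in [d], survive the evaluation of later subterms. *)
Lemma compile_correct t P p rho d R :
  code_at P p (compile p rho d t) ->
  R 0 = 1 -> R 1 = n -> R 2 = n.+1 -> 2 < d -> all (fun r => r < d) rho ->
  exists R', [/\ R' d = eval [seq R r | r <- rho] t,
    forall r, r < d -> R' r = R r
    & runs P (cost t) (Config p R M)
        (Config (p + size (compile p rho d t)) R' M)].
Proof.
elim: t p rho d R => [c|j|a IHa b IHb|a IHa b IHb|a IHa|b a IHa] p rho d R.
- move=> /code_at_cons[i0 _] R0 R1 R2 lt_d lt_rho /=.
  exists (update R d c); split=> [|r lt_r|].
  + by rewrite /update eqxx.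
  + by rewrite /update ltn_eqF.
  + by rewrite addn1; apply: runs_step; rewrite /step i0.
- move=> /code_at_cons[i0 /code_at_cons[i1 _]] R0 R1 R2 lt_d lt_rho /=.
  pose R' := update R d (R d - R d).
  exists (update R' d (R' d + R' (nth 0 rho j))); split=> [|r lt_r|].
  (* Clearing [d] does not affect the register read next: it is listed in [rho], hence below [d], or
     it is the default register 0. *)
  + rewrite /R' /update !eqxx subnn add0n ltn_eqF; last first.
      by have [lt_j|le_j] := ltnP j (size rho);
        [exact: (all_nthP 0 lt_rho) | rewrite nth_default // ltnW // ltnW].
    have [lt_j|le_j] := ltnP j (size rho); first by rewrite (nth_map 0).
    by rewrite !nth_default ?size_map.
  + by rewrite /R' /update ltn_eqF.
  + rewrite addn2; apply: (runs_trans (m1 := 1) (m2 := 1)).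
      by apply: runs_step; rewrite /step i0.
    by apply: runs_step; rewrite /step i1.
- move=> /= /code_at_cat[atA /code_at_cat[atB /code_at_cons[i0 _]]].
  move=> R0 R1 R2 lt_d lt_rho.
  have [Ra [vA fA rA]] := IHa _ _ _ _ atA R0 R1 R2 lt_d lt_rho.
  have lt_rho' : all (fun r => r < d.+1) rho.
    by apply: sub_all lt_rho => r /leqW.
  have [|||Rb [vB fB rB]] := IHb _ _ _ Ra atB _ _ _ (leqW lt_d) lt_rho';
    try by rewrite fA // (leq_trans _ lt_d).
  have envE : [seq Ra r | r <- rho] = [seq R r | r <- rho].
    by apply/eq_in_map => r /(allP lt_rho) /fA.
  exists (update Rb d (Rb d + Rb d.+1)); split=> [|r lt_r|].
  + by rewrite /update eqxx vB fB ?vA ?envE.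
  + by rewrite /update ltn_eqF // fB ?fA // leqW.
  + apply: runs_trans rA _; rewrite !size_cat !addnA; apply: runs_trans rB _.
    by rewrite addn1; apply: runs_step; rewrite /step i0.
- move=> /= /code_at_cat[atA /code_at_cat[atB /code_at_cons[i0 _]]].
  move=> R0 R1 R2 lt_d lt_rho.
  have [Ra [vA fA rA]] := IHa _ _ _ _ atA R0 R1 R2 lt_d lt_rho.
  have lt_rho' : all (fun r => r < d.+1) rho.
    by apply: sub_all lt_rho => r /leqW.
  have [|||Rb [vB fB rB]] := IHb _ _ _ Ra atB _ _ _ (leqW lt_d) lt_rho';
    try by rewrite fA // (leq_trans _ lt_d).
  have envE : [seq Ra r | r <- rho] = [seq R r | r <- rho].
    by apply/eq_in_map => r /(allP lt_rho) /fA.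
  exists (update Rb d (Rb d - Rb d.+1)); split=> [|r lt_r|].
  + by rewrite /update eqxx vB fB ?vA ?envE.
  + by rewrite /update ltn_eqF // fB ?fA // leqW.
  + apply: runs_trans rA _; rewrite !size_cat !addnA; apply: runs_trans rB _.
    by rewrite addn1; apply: runs_step; rewrite /step i0.
- move=> /= /code_at_cat[atA /code_at_cons[i0 _]] R0 R1 R2 lt_d lt_rho.
  have [Ra [vA fA rA]] := IHa _ _ _ _ atA R0 R1 R2 lt_d lt_rho.
  exists (update Ra d (M (Ra d))); split=> [|r lt_r|].
  + by rewrite /update eqxx vA.
  + by rewrite /update ltn_eqF // fA.
  + apply: runs_trans rA _; rewrite size_cat addnA addn1; apply: runs_step.
    by rewrite /step i0.
- move=> /=; set body := compile _ _ _ _; set q := (p + 5 + size body).+1.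
  move=> /code_at_cons[i0 /code_at_cons[i1 /code_at_cons[i2 /code_at_cons[i3]]]].
  move=> /code_at_cons[i4 /code_at_cat[atA /code_at_cons[i5 /code_at_cons[i6 _]]]].
  move: i5 i6 atA.
  have -> : (p.+4.+1 + size body).+1 = q by rewrite /q; lia.
  have -> : p.+4.+1 = p + 5 by lia.
  move=> i5 i6 atA R0 R1 R2 lt_d lt_rho.
  have d1 : (d == d.+1) = false by rewrite ltn_eqF.
  have d1' : (d.+1 == d) = false by rewrite gtn_eqF.
  have dr r : r < d -> ((r == d) = false) * ((r == d.+1) = false).
    by move=> lt_r; rewrite !ltn_eqF // leqW.
  pose env := [seq R r | r <- rho].
  (* The counter is decremented before the body runs, so the body sees the values [m - 1] down to 0:
     the sum is accumulated from its last term. *)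
  have loop m R1' : R1' d.+1 = m -> (forall r, r < d -> R1' r = R r) ->
      exists R', [/\ R' d = R1' d + \sum_(x < m) eval (rcons env x) a,
        forall r, r < d -> R' r = R r
        & runs P (m * (cost a + 3) + 1) (Config q R1' M) (Config q.+1 R' M)].
    elim: m R1' => [|m IHm] R' R'm R'R.
      exists R'; rewrite big_ord0 addn0; split=> //.
      by apply: runs_step; rewrite /step i6 R'm.
    pose Ri := update R' d.+1 (R' d.+1 - R' 0).
    have Rid : Ri d.+1 = m.
      by rewrite /Ri /update eqxx R'm R'R ?R0 ?subn1 // ltnW // ltnW.
    have RiR r : r < d -> Ri r = R r.
      by move=> lt_r; rewrite /Ri /update dr // R'R.
    have lt_rho' : all (fun r => r < d.+2) (rcons rho d.+1).
      rewrite all_rcons ltnSn /=; apply: sub_all lt_rho => r lt_r.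
      by rewrite ltnW // ltnW.
    have [|||Rb [vB fB rB]] :=
        IHa _ _ _ Ri atA _ _ _ (leqW (leqW lt_d)) lt_rho';
      try by rewrite RiR // (leq_trans _ lt_d).
    have envE : [seq Ri r | r <- rcons rho d.+1] = rcons env m.
      rewrite map_rcons Rid; congr rcons.
      by apply/eq_in_map => r /(allP lt_rho) /RiR.
    pose Rc := update Rb d (Rb d + Rb d.+2).
    have [||R2' [v2 f2 r2]] := IHm Rc.
    + by rewrite /Rc /update d1' fB // Rid.
    + by move=> r lt_r; rewrite /Rc /update dr // fB ?RiR // ltnW // ltnW.
    exists R2'; split=> //.
      rewrite v2 /Rc {1}/update eqxx vB envE fB; last by rewrite ltnW.
      by rewrite {1}/Ri {1}/update d1 big_ord_recr /= -addnA [X in _ + X]addnC.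
    have -> : m.+1 * (cost a + 3) + 1 =
        1 + (1 + (cost a + (1 + (m * (cost a + 3) + 1)))) by lia.
    apply: runs_trans; first by apply: runs_step; rewrite /step i6 R'm /=.
    rewrite addn4; apply: runs_trans; first by apply: runs_step; rewrite /step i4.
    have -> : p.+4.+1 = p + 5 by lia.
    apply: runs_trans rB _; apply: runs_trans r2.
    by apply: runs_step; rewrite /step i5.
  pose Ra := update R d (R d - R d).
  pose Rb := update Ra d.+1 (Ra d.+1 - Ra d.+1).
  pose Rc := update Rb d.+1 (Rb d.+1 + Rb b.+1).
  have RcR r : r < d -> Rc r = R r.
    by move=> lt_r; rewrite /Rc /Rb /Ra /update !dr.
  have lt_b : b.+1 < d by case: (b) => //; exact: ltnW.
  have [|R' [v' f' r']] := loop (n + b) Rc _ RcR.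
    rewrite /Rc {1}/update eqxx /Rb {1}/update eqxx subnn add0n /update !dr //.
    by rewrite /Ra /update !dr //; case: (b); rewrite ?R2 ?R1 ?addn0 ?addn1.
  exists R'; split=> //.
    by rewrite v' /Rc /Rb /Ra /update !d1 eqxx subnn.
  have -> : p + (size (body ++ [:: Add d d d.+2; JumpPos d.+1 (p + 4)])).+4.+1 = q.+1.
    by rewrite size_cat /q /=; lia.
  apply: runs_trans r'; rewrite -[4]/(1 + (1 + (1 + 1))).
  do 3![apply: runs_trans; first by apply: runs_step; rewrite /step ?i0 ?i1 ?i2].
  by apply: runs_step; rewrite /step i3 -/Ra -/Rb -/Rc RcR ?R0 // ltnW // ltnW.
Qed.

End Semantics.

Fixpoint cost_poly (t : term) : {poly nat} :=
  (match t with
  | Cst _ => 1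
  | Var _ => 2
  | Plus a b | Minus a b => cost_poly a + (cost_poly b + 1)
  | Fetch a => cost_poly a + 1
  | Sum b a => 4 + (('X + (nat_of_bool b)%:P) * (cost_poly a + 3) + 1)
  end)%R.

Lemma horner_natr (m n : nat) : (m%:R : {poly nat}).[n]%R = m.
Proof. by rewrite -polyC_natr hornerC natn. Qed.

Lemma horner_cost_poly n t : (cost_poly t).[n]%R = cost n t.
Proof.
elim: t => [c|j|a IHa b IHb|a IHa b IHb|a IHa|b a IHa] /=;
  by rewrite ?(hornerD, hornerM) ?hornerX ?hornerC ?IHa ?IHb
    ?horner_natr ?(horner_natr 1).
Qed.

(** Four instructions load 1, [n] (read from cell 0) and [n + 1] into registers 0 to 2; after the
    code of [t], a jump on its value and a halt give the answer. This is the constant 6 in the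
    polynomial. *)
Lemma eval_polytime (t : term) : exists (P : program) (p : {poly nat}), forall x,
  run P p.[nth 0 x 0]%R (init x) = Some (0 < eval (nth 0 x) (nth 0 x 0) [::] t).
Proof.
pose code := compile 4 [::] 3 t; pose q := 4 + size code.
pose P := [:: Const 0 1; Const 1 0; Read 1 1; Add 2 1 0] ++ code
  ++ [:: JumpPos 3 q.+2; Halt false; Halt true].
exists P, (cost_poly t + 6)%R => x; set M := nth 0 x; set n := M 0.
rewrite hornerD horner_cost_poly horner_natr.
have nthq i : nth (Halt false) P (q + i) =
    nth (Halt false) [:: JumpPos 3 q.+2; Halt false; Halt true] i.
  by rewrite /P nth_cat /q -addnA ltnNge leq_addr /= addKn nth_cat ltnNge
    leq_addr addKn.
have atP : code_at P 4 code.
  by move=> i lt_i; rewrite /P nth_cat ltnNge leq_addr addKn nth_cat lt_i.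
pose R1 := update (fun=> 0) 0 1.
pose R2 := update R1 1 0.
pose R3 := update R2 1 (M (R2 1)).
pose R4 := update R3 2 (R3 1 + R3 0).
have [//|//||//|//|R [vR _ rR]] := @compile_correct M n t P 4 [::] 3 R4 atP.
  by rewrite /R4 /R3 /update /= addn1.
have run4 : runs P 4 (init x) (Config 4 R4 M) by [].
have -> : (cost n t + 6)%R = 4 + cost n t + 2 by lia.
rewrite (runs_trans run4 rR) -vR /run /step.
have := nthq 0; rewrite addn0 => ->.
have := nthq 1; rewrite addn1 => i1; have := nthq 2; rewrite addn2 => i2.
by rewrite -/q /=; case: (ltnP 0 (R 3)) => _; rewrite ?i1 ?i2.
Qed.

(** * The search over pairs of covers, written as a term *)

Definition absdiff (a b : term) : term := Plus (Minus a b) (Minus b a).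

(** Cells 0 to 2 hold [n], [k] and [l]; the source vector starts at 3, the target vector at [3 + n]
    and the matrix at [3 + n + n]. *)
Definition source (x : term) : term := Fetch (Plus (Cst 3) x).
Definition target (x : term) : term :=
  Fetch (Plus (Plus (Cst 3) (Fetch (Cst 0))) x).

(* The row offset x * n is obtained by adding x to itself n times. *)
Definition adjacent (x y : term) : term :=
  Fetch (Plus (Plus (Plus (Plus (Cst 3) (Fetch (Cst 0))) (Fetch (Cst 0)))
                   (Sum false x)) y).

(** With truncated subtraction, 1 minus the absolute difference of [x] and [v] is the indicator of
    [x = v]. *)
Definition without (A : term -> term) (v : term) (x : term) : term :=
  Minus (A x) (Minus (Cst 1) (absdiff x v)).

(* In the following terms, the variables 0 and 1 stand for the vertices removed
   from the source and from the target cover. *)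
Definition uncovered (A : term -> term) : term :=
  Sum false (Sum false
    (Minus (adjacent (Var 2) (Var 3)) (Plus (A (Var 2)) (A (Var 3))))).
Definition oversize (A : term -> term) : term :=
  Minus (Plus (Sum false (A (Var 2))) (Cst 1)) (Fetch (Cst 1)).
Definition distance (A B : term -> term) : term :=
  Sum false (absdiff (A (Var 2)) (B (Var 2))).
(** Each summand vanishes exactly when its condition holds, so the whole is 0 exactly when all
    conditions hold. *)
Definition infeasible (A B A' B' : term -> term) : term :=
  Plus (Plus (Plus (uncovered A') (uncovered B'))
             (Plus (oversize A') (oversize B')))
       (Minus (Plus (Plus (distance A A') (distance A' B')) (distance B' B))
              (Fetch (Cst 2))).

(* [Sum true] also ranges over n, which is not a vertex: it stands for removing
   nothing. *)
Definition solver : term :=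
  Sum true (Sum true
    (Plus (Minus (Cst 1) (distance source target))
          (Minus (Cst 1) (infeasible source target
             (without source (Var 0)) (without target (Var 1)))))).

Lemma nth_allpairs (A B C : Type) (f : A -> B -> C) s t x0 y0 z0 i j :
  i < size s -> j < size t ->
  nth z0 [seq f x y | x <- s, y <- t] (i * size t + j) =
    f (nth x0 s i) (nth y0 t j).
Proof.
elim: s i => [//|x s IH] [|i] /= lt_i lt_j; rewrite nth_cat size_map.
  by rewrite add0n lt_j (nth_map y0).
by rewrite mulSn -addnA ltnNge leq_addr addKn IH.
Qed.

(** * Correctness of the search on encoded instances *)

Section Correctness.
Variable I : vcr_instance.

Let n := vcr_n I.
Let M := nth 0 (vcr_encode I).

Lemma mem_n : M 0 = n. Proof. by []. Qed.
Lemma mem_k : M 1 = vcr_k I. Proof. by []. Qed.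

Lemma mem_source (x : 'I_n) : M (3 + x) = (x \in vcr_source I).
Proof.
rewrite /M /vcr_encode nth_cat /= add3n /= subSS subSS subSS subn0.
by rewrite nth_cat size_map size_enum_ord ltn_ord (nth_map x)
  ?nth_ord_enum ?size_enum_ord.
Qed.

Lemma mem_target (x : 'I_n) : M (3 + n + x) = (x \in vcr_target I).
Proof.
rewrite -addnA /M /vcr_encode nth_cat /= add3n /= subSS subSS subSS subn0.
rewrite nth_cat size_map size_enum_ord ltnNge leq_addr addKn /=.
by rewrite nth_cat size_map size_enum_ord ltn_ord (nth_map x)
  ?nth_ord_enum ?size_enum_ord.
Qed.

Lemma mem_edge (x y : 'I_n) : M (3 + n + n + x * n + y) = vcr_edge x y.
Proof.
rewrite -!addnA /M /vcr_encode nth_cat /= add3n /= subSS subSS subSS subn0.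
rewrite nth_cat size_map size_enum_ord ltnNge leq_addr addKn /=.
rewrite nth_cat size_map size_enum_ord ltnNge leq_addr addKn /=.
rewrite -[n in x * n]size_enum_ord (nth_allpairs _ x y) ?size_enum_ord //.
by rewrite !nth_ord_enum.
Qed.

(** The environment may have any depth, since vectors are read below several binders; its first two
    entries are fixed because [without] refers to them. *)
Definition denotes (v w : nat) (f : term -> term) (A : {set 'I_n}) : Prop :=
  forall env j (x : 'I_n), nth 1 env j = x -> nth 1 env 0 = v ->
    nth 1 env 1 = w -> eval M n env (f (Var j)) = (x \in A).

Definition remove (A : {set 'I_n}) (v : nat) := [set x in A | x != v :> nat].

(** The extra index [n] accounts for removing nothing. Conversely, an index that is not a vertex of
    [A] leaves [A] unchanged. *)
Lemma shrink_remove A A' : shrink A A' <-> exists v : 'I_n.+1, A' = remove A v.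
Proof.
split=> [[-> | [v vA ->]] | [v ->]].
- exists ord_max; apply/setP => x; rewrite !inE.
  by rewrite neq_ltn ltn_ord andbT.
- by exists (widen_ord (leqnSn n) v); apply/setP => x; rewrite !inE andbC.
have [lt_v | le_v] := ltnP v n; last first.
  left; apply/setP => x; rewrite !inE.
  by rewrite ltn_eqF ?andbT // (leq_trans (ltn_ord x)).
have remE : remove A v = A :\ Ordinal lt_v.
  by apply/setP => x; rewrite !inE andbC.
have [vA | nvA] := boolP (Ordinal lt_v \in A).
  by right; exists (Ordinal lt_v).
left; rewrite remE; apply/setP => x; rewrite !inE.
by have [-> | //] := eqVneq x (Ordinal lt_v); rewrite (negPf nvA).
Qed.

Lemma denotes_source v w : denotes v w source (vcr_source I).
Proof. by move=> env j x /= -> _ _; rewrite mem_source. Qed.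

Lemma denotes_target v w : denotes v w target (vcr_target I).
Proof. by move=> env j x /= -> _ _; rewrite mem_n mem_target. Qed.

Lemma denotes_without v w f A j u :
  (forall env, nth 1 env 0 = v -> nth 1 env 1 = w -> nth 1 env j = u) ->
  denotes v w f A -> denotes v w (without f (Var j)) (remove A u).
Proof.
move=> ju fA env i x ix env0 env1; rewrite /= (fA _ _ _ ix) // ix (ju env) // inE.
by case: (x \in A); lia.
Qed.

Variables (v w : nat) (f g : term -> term) (A B : {set 'I_n}).
Hypotheses (fA : denotes v w f A) (gB : denotes v w g B).

Lemma eval_uncovered :
  (eval M n [:: v; w] (uncovered f) == 0) = vertex_cover (@vcr_edge I) A.
Proof.
rewrite /= addn0 sum_nat_eq0; apply: eq_forallb => x /=.
rewrite sum_nat_eq0; apply: eq_forallb => y /=.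
rewrite (@fA _ 2 x) // (@fA _ 3 y) // mem_n sum_nat_const card_ord mulnC mem_edge.
by case: (vcr_edge x y); case: (x \in A); case: (y \in A).
Qed.

Lemma eval_oversize :
  (eval M n [:: v; w] (oversize f) == 0) = (#|A| < vcr_k I).
Proof.
rewrite /= addn0 (eq_bigr (fun x : 'I_n => nat_of_bool (x \in A))); last first.
  by move=> x _; rewrite (@fA _ 2 x).
by rewrite -big_mkcond /= sum1_card mem_k subn_eq0 addn1.
Qed.

Lemma eval_distance : eval M n [:: v; w] (distance f g) = hdist A B.
Proof.
rewrite /= addn0; apply: eq_bigr => x _; rewrite (@fA _ 2 x) // (@gB _ 2 x) //.
by case: (x \in A); case: (x \in B).
Qed.

End Correctness.

Lemma eval_infeasible (I : vcr_instance) v w f g f' g'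
    (A B A' B' : {set 'I_(vcr_n I)}) :
  @denotes I v w f A -> @denotes I v w g B ->
  @denotes I v w f' A' -> @denotes I v w g' B' ->
  (eval (nth 0 (vcr_encode I)) (vcr_n I) [:: v; w] (infeasible f g f' g') == 0) =
  [&& vertex_cover (@vcr_edge I) A' && vertex_cover (@vcr_edge I) B',
    (#|A'| < vcr_k I) && (#|B'| < vcr_k I)
    & hdist A A' + hdist A' B' + hdist B' B <= vcr_l I].
Proof.
move=> fA gB fA' gB'; set M := nth 0 _; set n := vcr_n I.
(* Unfolding only the outer operations keeps the subterms in the form that the evaluation lemmas
   match. *)
have evalD a b : eval M n [:: v; w] (Plus a b) =
  eval M n [:: v; w] a + eval M n [:: v; w] b by [].
have evalB a : eval M n [:: v; w] (Minus a (Fetch (Cst 2))) =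
  eval M n [:: v; w] a - vcr_l I by [].
rewrite /infeasible !evalD evalB !evalD !addn_eq0 subn_eq0.
rewrite (eval_uncovered fA') (eval_uncovered gB').
rewrite (eval_oversize fA') (eval_oversize gB').
by rewrite (eval_distance fA fA') (eval_distance fA' gB') (eval_distance gB' gB)
  -andbA.
Qed.

(** A sum of naturals is positive exactly when some summand is, so the double sum acts as an
    existential quantifier over the pairs of removals. *)
Lemma eval_solver (I : vcr_instance) :
  is_tree (@vcr_edge I) ->
  0 < eval (nth 0 (vcr_encode I)) (vcr_n I) [::] solver <-> vcr_yes I.
Proof.
case=> _ _ acyc; rewrite /vcr_yes (reconfigurable_iff_shrink (vcr_graphP I) acyc);
  rewrite ?vcr_sourceP ?vcr_targetP ?vcr_source_le ?vcr_target_le //.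
set S := vcr_source I; set T := vcr_target I; set M := nth 0 _; set n := vcr_n I.
pose S' v := remove S v; pose T' w := remove T w.
have pairP v w : 0 < 1 - eval M n [:: v; w] (distance source target)
    + (1 - eval M n [:: v; w] (infeasible source target
             (without source (Var 0)) (without target (Var 1)))) <->
  S = T \/ [/\ vertex_cover (@vcr_edge I) (S' v)
      && vertex_cover (@vcr_edge I) (T' w),
    (#|S' v| < vcr_k I) && (#|T' w| < vcr_k I)
    & hdist S (S' v) + hdist (S' v) (T' w) + hdist (T' w) T <= vcr_l I].
  have sS := @denotes_source I v w; have tT := @denotes_target I v w.
  have sS' : denotes v w (without source (Var 0)) (S' v).
    by apply: denotes_without sS => env ->.
  have tT' : denotes v w (without target (Var 1)) (T' w).
    by apply: denotes_without tT => env _ ->.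
  rewrite addn_gt0 !subn_gt0 !ltnS !leqn0 (eval_distance sS tT) hdist_eq0.
  rewrite (eval_infeasible sS tT sS' tT').
  split=> [/orP[/eqP | /and3P[]] | [/eqP ST | [vc lt_k le_l]]]; [by left | by right | |].
    by apply/orP; left.
  by rewrite vc lt_k le_l orbT.
have -> : eval M n [::] solver = \sum_(v < n.+1) \sum_(w < n.+1)
    (1 - eval M n [:: val v; val w] (distance source target)
     + (1 - eval M n [:: val v; val w] (infeasible source target
             (without source (Var 0)) (without target (Var 1))))).
  by rewrite -addn1.
rewrite lt0n sum_nat_eq0 negb_forall; split.
  case/existsP=> v; rewrite sum_nat_eq0 negb_forall => /existsP[w].
  rewrite -lt0n => /pairP[ST | [vc lt_k le_l]]; [by left | right].
  exists (S' v), (T' w); split=> //; apply/shrink_remove; first by exists v.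
  by exists w.
move=> yes; suff [v [w pos]] : exists v w : 'I_n.+1,
    0 < 1 - eval M n [:: val v; val w] (distance source target)
      + (1 - eval M n [:: val v; val w] (infeasible source target
             (without source (Var 0)) (without target (Var 1)))).
  apply/existsP; exists v; rewrite sum_nat_eq0 negb_forall.
  by apply/existsP; exists w; rewrite -lt0n.
case: yes => [ST | [S1 [T1 [/shrink_remove[v ->] /shrink_remove[w ->] vc lk ll]]]].
  (* The test for [S = T] succeeds at every pair of indices, and index 0 exists because the range
     has [n + 1] elements. *)
  by exists ord0, ord0; apply/pairP; left.
by exists v, w; apply/pairP; right.
Qed.

Theorem theorem2 :
  solvable_in_polytime vcr_encode vcr_n
    (fun I : vcr_instance => is_tree (@vcr_edge I)) vcr_yes.
Proof.
have [P [p runP]] := eval_polytime solver; exists P, p => I treeI.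
exists (0 < eval (nth 0 (vcr_encode I)) (vcr_n I) [::] solver).
(* The first entry of the encoding is [vcr_n I], so the two time bounds agree by computation. *)
split; first exact: (runP (vcr_encode I)).
exact: eval_solver.
Qed.
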